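(* Let $m>1$ be an integer, let $x_{-1},\dots,x_{-m}\in\{-1,1\}$, and let $\omega_0,\omega_1,\dots,\omega_m\in\mathbb{R}$ satisfy $$\left|\omega_0-\tfrac12\right|+\sum_{i=1}^m|\omega_i|<\tfrac12.$$ Let $X_0,X_1,X_2,\dots$ be the $\{-1,1\}$-valued process with initial conditions $X_{-i}=x_{-i}$ for $i=1,\dots,m$ and $$\Pr(X_k=1\mid X_{k-1},X_{k-2},\dots)=\Pr(X_k=1\mid X_{k-1},\dots,X_{k-m})=\omega_0+\sum_{i=1}^m\omega_iX_{k-i},\qquad k\ge 0.$$ Then the unconditional probabilities $p_k=\Pr(X_k=1)$ satisfy the recursion $$p_k=\omega_0-\sum_{i=1}^m\omega_i+2\sum_{i=1}^m\omega_i\,p_{k-i},\qquad k=0,1,2,\dots,$$ with $p_{-i}=\frac{x_{-i}+1}{2}$ for $i=1,\dots,m$. Moreover, $p_k$ converges as $k\to\infty$ to the steady-state unconditional probability $$p_\infty=\frac{\omega_0-(\omega_1+\cdots+\omega_m)}{1-2(\omega_1+\cdots+\omega_m)}.$$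
   Context: The process models a coin with memory depth $m$: $X_k=1$ is a head and $X_k=-1$ a tail on flip $k$. The values $x_{-1},\dots,x_{-m}$ are fixed, already observed outcomes, and ''unconditional'' probabilities are those of the process started from these fixed values. *)

(* Defs.v *)
From HB Require Import structures.
From mathcomp Require Import all_boot all_order all_algebra.
From mathcomp Require Import all_classical all_reals all_analysis.

Set Implicit Arguments.
Unset Strict Implicit.
Unset Printing Implicit Defensive.

Import Order.TTheory GRing.Theory Num.Theory.
Import numFieldNormedType.Exports.

Local Open Scope classical_set_scope.
Local Open Scope ring_scope.

(* Elementary conditional probability P(A | B); only meaningful when
   P B <> 0. *)
Definition cond_prob (R : realType) (d : measure_display)
    (T : measurableType d) (P : probability T R) (A B : set T) : R :=
  fine (P (A `&` B)) / fine (P B).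

(* Processes are indexed by int. For a process with memory m started at time
   0, only the times j >= -m matter; nothing is ever required of X j for
   j < -m. *)

Definition heads (R : realType) (d : measure_display) (T : measurableType d)
    (P : probability T R) (X : int -> {RV P >-> R}) (k : int) : set T :=
  [set t | X k t = 1].

Definition head_prob (R : realType) (d : measure_display)
    (T : measurableType d) (P : probability T R) (X : int -> {RV P >-> R})
    (k : int) : R :=
  fine (P (heads X k)).

(* The event that X_{k-1}, X_{k-2}, ..., X_{-m} take the values prescribed
   by a. *)
Definition past_event (R : realType) (d : measure_display)
    (T : measurableType d) (P : probability T R) (X : int -> {RV P >-> R})
    (m : nat) (k : int) (a : int -> R) : set T :=
  [set t | forall j : int, - m%:Z <= j -> j < k -> X j t = a j].

(* The event that X_{k-1}, ..., X_{k-m} take the values prescribed by a. *)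
Definition recent_event (R : realType) (d : measure_display)
    (T : measurableType d) (P : probability T R) (X : int -> {RV P >-> R})
    (m : nat) (k : int) (a : int -> R) : set T :=
  [set t | forall i : nat, (1 <= i <= m)%N ->
     X (k - i%:Z) t = a (k - i%:Z)].

(* All variables take finitely many values, so a conditional probability given
   variables is specified by its values on the events of positive probability
   on which these variables are constant. The last two clauses are, for k >= 0,
     Pr(X_k = 1 | X_{k-1}, X_{k-2}, ...) = Pr(X_k = 1 | X_{k-1}, ..., X_{k-m}),
     Pr(X_k = 1 | X_{k-1}, ..., X_{k-m}) = w_0 + \sum_i w_i X_{k-i}. *)
Record coin_process (R : realType) (d : measure_display)
    (T : measurableType d) (P : probability T R) (m : nat) (x : int -> R)
    (w : nat -> R) (X : int -> {RV P >-> R}) : Prop := CoinProcess {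
  coin_values : forall (k : int) (t : T), - m%:Z <= k ->
    X k t = 1 \/ X k t = -1 ;
  coin_init : forall (i : nat) (t : T), (1 <= i <= m)%N ->
    X (- i%:Z) t = x (- i%:Z) ;
  coin_markov : forall (k : nat) (a : int -> R),
    (0 < P (past_event X m k%:Z a))%E ->
    cond_prob P (heads X k%:Z) (past_event X m k%:Z a) =
    cond_prob P (heads X k%:Z) (recent_event X m k%:Z a) ;
  coin_transition : forall (k : nat) (a : int -> R),
    (0 < P (recent_event X m k%:Z a))%E ->
    cond_prob P (heads X k%:Z) (recent_event X m k%:Z a) =
    w 0%N + \sum_(1 <= i < m.+1) w i * a (k%:Z - i%:Z) }.

(* Main.v *)
Require Import Defs.
From HB Require Import structures.
From mathcomp Require Import all_boot all_order all_algebra.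
From mathcomp Require Import all_classical all_reals all_analysis.
From mathcomp Require Import ring lra zify.

Set Implicit Arguments.
Unset Strict Implicit.
Unset Printing Implicit Defensive.

Import Order.TTheory GRing.Theory Num.Theory.
Import numFieldNormedType.Exports.

Local Open Scope classical_set_scope.
Local Open Scope ring_scope.

(** Taking expectations in the transition rule, with E X_j = 2 p_j - 1, gives
the recursion for p_k. Here the expectation is a finite sum: the events
fixing which of the last m flips were heads partition the space
([total_probability]), each nonempty one is a [recent_event], so the transition
rule gives its share of the event that flip k is a head
([heads_and_pattern]), and summing over all patterns yields
[head_prob_rec]. The transition rule only covers patterns of positive
probability; the others contribute zero to both sides.

For the limit, p_infty is the fixed point of the recursion, so the error
q_k = p_k - p_infty satisfies the homogeneous recursion with coefficients
2 w_i. The hypothesis makes rho = 2 (|w_1| + ... + |w_m|) smaller than 1, so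
|q_k| is at most rho times the largest of the previous m errors. Hence each
block of m steps gains a factor rho, and q_k tends to 0
([delayed_contraction_cvg0]). *)

Section TotalProbability.
Context (R : realType) (d : measure_display) (T : measurableType d)
  (P : probability T R).

Lemma total_probability (F : finType) (f : T -> F) (A : set T) :
  measurable A -> (forall c, measurable (f @^-1` [set c])) ->
  fine (P A) = \sum_(c : F) fine (P (A `&` f @^-1` [set c])).
Proof.
move=> mA mf.
have mAf c : measurable (A `&` f @^-1` [set c]) by exact: measurableI.
have AE : A = \bigcup_(c in [set: F]) (A `&` f @^-1` [set c]).
  by apply/seteqP; split=> [t At|t [c _ []]//]; exists (f t).
rewrite {1}AE measure_fin_bigcup //; last first.
- exact: trivIset_preimage1_in.
- exact: finite_finset.
rewrite (_ : [set: F] = [set` index_enum F]); last first.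
  by apply/seteqP; split=> c //= _; rewrite mem_index_enum.
rewrite -fsbig_seq ?index_enum_uniq // sum_fine // => c _.
exact: fin_num_measure.
Qed.

End TotalProbability.

Section Recursion.
Context (R : realType) (d : measure_display) (T : measurableType d)
  (P : probability T R) (m : nat) (X : int -> {RV P >-> R}).

(** Coordinate i records flip k - (i + 1), as ordinals start at 0 while the
memory covers flips k - 1, ..., k - m. *)
Definition head_pattern (k : int) (t : T) : {ffun 'I_m -> bool} :=
  [ffun i : 'I_m => X (k - i.+1%:Z) t == 1].

Context (X_pm1 : forall (k : int) (t : T), - m%:Z <= k ->
  X k t = 1 \/ X k t = -1).

Lemma coin_valueE (k : int) (t : T) : - m%:Z <= k ->
  X k t = 2 * (X k t == 1)%:R - 1.
Proof.
move=> /(X_pm1 t) [|] ->; first by rewrite eqxx /=; ring.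
have /negbTE-> : -1 != 1 :> R by apply/eqP => ?; lra.
by rewrite /=; ring.
Qed.

Lemma measurable_heads (k : int) : measurable (heads X k).
Proof. exact: (measurable_funPTI (X k) (measurable_set1 1)). Qed.

Lemma measurable_recent_event (k : int) (a : int -> R) :
  measurable (recent_event X m k a).
Proof.
rewrite (_ : recent_event _ _ _ _ = \bigcap_(i in [set i | (1 <= i <= m)%N])
  (X (k - i%:Z) @^-1` [set a (k - i%:Z)])); last first.
  by apply/seteqP; split=> t /= h i; exact: h.
apply: bigcap_measurableType => i _.
exact: (measurable_funPTI (X (k - i%:Z)) (measurable_set1 _)).
Qed.

(** Taking the path of an outcome [t] itself as the prescribed values avoids
decoding a pattern into a sequence of signs. *)
Lemma recent_event_pattern (k : nat) (t : T) :
  recent_event X m k%:Z (fun j => X j t) =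
  head_pattern k%:Z @^-1` [set head_pattern k%:Z t].
Proof.
apply/seteqP; split=> [s /= h|s /= /ffunP h].
  by apply/ffunP => i; rewrite !ffunE h //= ltn_ord.
case=> [//|i] /= im.
have := h (Ordinal im); rewrite !ffunE /= => e.
by rewrite coin_valueE ?e -?coin_valueE //; lia.
Qed.

Lemma measurable_pattern (k : nat) (c : {ffun 'I_m -> bool}) :
  measurable (head_pattern k%:Z @^-1` [set c]).
Proof.
have [->|/set0P [t /= <-]] := eqVneq (head_pattern k%:Z @^-1` [set c]) set0.
  exact: measurable0.
by rewrite -recent_event_pattern; exact: measurable_recent_event.
Qed.

Lemma head_prob_patterns (k : nat) (i : 'I_m) :
  head_prob X (k%:Z - i.+1%:Z) =
  \sum_(c : {ffun 'I_m -> bool})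
    (c i)%:R * fine (P (head_pattern k%:Z @^-1` [set c])).
Proof.
rewrite /head_prob
  (total_probability P (measurable_heads _) (measurable_pattern k)).
apply: eq_bigr => c _.
have [ci|ci] := boolP (c i); rewrite ?mul1r ?mul0r.
  congr (fine (P _)); apply/setIidr => t /= e.
  by move: ci; rewrite -e ffunE => /eqP.
rewrite (_ : _ `&` _ = set0) ?measure0 //.
rewrite -subset0 => t [/= h e]; move: ci.
by rewrite -e ffunE => /eqP; apply.
Qed.

Lemma sum_patterns (k : nat) :
  \sum_c fine (P (head_pattern k%:Z @^-1` [set c])) = 1.
Proof.
have := total_probability P (@measurableT _ T) (measurable_pattern k).
rewrite probability_setT /= => ->.
by apply: eq_bigr => c _; rewrite setTI.
Qed.

Context (w : nat -> R).
Context (X_transition : forall (k : nat) (a : int -> R),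
  (0 < P (recent_event X m k%:Z a))%E ->
  cond_prob P (heads X k%:Z) (recent_event X m k%:Z a) =
  w 0%N + \sum_(1 <= i < m.+1) w i * a (k%:Z - i%:Z)).

(** The transition rule in product form, which also holds for patterns of
probability zero; 2 * (c i)%:R - 1 is the sign that the pattern [c] prescribes
for flip k - (i + 1). *)
Lemma heads_and_pattern (k : nat) (c : {ffun 'I_m -> bool}) :
  fine (P (heads X k%:Z `&` head_pattern k%:Z @^-1` [set c])) =
  (w 0%N + \sum_(i < m) w i.+1 * (2 * (c i)%:R - 1)) *
    fine (P (head_pattern k%:Z @^-1` [set c])).
Proof.
set E := _ @^-1` _.
have mE : measurable E by exact: measurable_pattern.
have mHE : measurable (heads X k%:Z `&` E).
  by apply: measurableI => //; exact: measurable_heads.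
have [PE0|PE0] := eqVneq (P E) 0%E.
  rewrite PE0 mulr0 (_ : P _ = 0%E) //.
  by apply/eqP; rewrite eq_le measure_ge0 andbT -PE0 le_measure ?inE //.
have PEgt0 : (0 < P E)%E by rewrite lt_neqAle eq_sym PE0 measure_ge0.
(* A pattern of positive probability is realized by some outcome. *)
have /set0P[t Et] : E != set0 by apply: contraNneq PE0 => ->; rewrite measure0.
have EE : E = recent_event X m k%:Z (fun j => X j t).
  by rewrite recent_event_pattern /E Et.
have := X_transition (k := k) (a := fun j => X j t).
rewrite -EE => /(_ PEgt0); rewrite /cond_prob big_add1 big_mkord /=.
under eq_bigr => i _.
  rewrite coin_valueE; last by have := ltn_ord i; lia.
  have -> : (X (k%:Z - i.+1%:Z) t == 1) = c i by rewrite -Et ffunE.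
  over.
move=> <-; rewrite divfK // fine_eq0 //; exact: fin_num_measure.
Qed.

Lemma head_prob_rec (k : nat) :
  head_prob X k%:Z = w 0%N - \sum_(1 <= i < m.+1) w i
    + 2 * \sum_(1 <= i < m.+1) w i * head_prob X (k%:Z - i%:Z).
Proof.
rewrite !big_add1 !big_mkord /=.
rewrite {1}/head_prob
  (total_probability P (measurable_heads _) (measurable_pattern k)).
rewrite (eq_bigr _ (fun c _ => heads_and_pattern k c)).
under eq_bigr => c _ do rewrite mulrDl mulr_suml.
rewrite big_split /= -mulr_sumr sum_patterns mulr1 exchange_big /=.
rewrite -addrA; congr (_ + _).
rewrite mulr_sumr -sumrN -big_split /=; apply: eq_bigr => i _.
rewrite head_prob_patterns.
(* Spread the constant term over the patterns, whose probabilities sum to 1. *)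
transitivity (- w i.+1 * 1 + 2 * w i.+1 *
  \sum_(c : {ffun 'I_m -> bool})
    (c i)%:R * fine (P (head_pattern k%:Z @^-1` [set c]))); last by ring.
rewrite -[X in _ * X + _](sum_patterns k) !mulr_sumr -big_split /=.
by apply: eq_bigr => c _; ring.
Qed.

End Recursion.

(** Induction on [n], where block [n] starts at time n m - m: a time in block
[n.+1] only looks back at times in block [n] or later, where the previous
bound applies to every term. *)
Lemma delayed_contraction_bound (R : realType) (m : nat) (w : nat -> R)
    (q : int -> R) (M : R) :
  (forall j, `|q j| <= M) ->
  (forall k : nat, q k%:Z = \sum_(1 <= i < m.+1) w i * q (k%:Z - i%:Z)) ->
  forall n (j : int), n%:Z * m%:Z - m%:Z <= j ->
  `|q j| <= M * (\sum_(1 <= i < m.+1) `|w i|) ^+ n.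
Proof.
move=> qM qrec; elim=> [|n IH] j jn; first by rewrite expr0 mulr1.
have [k jk] : exists k : nat, j = k%:Z by exists `|j|%N; nia.
rewrite {j}jk in jn *.
rewrite qrec exprSr mulrA mulr_sumr.
apply: le_trans (ler_norm_sum _ _ _) _.
apply: ler_sum_nat => i /andP[i1 im].
by rewrite normrM mulrC ler_wpM2r // IH //; nia.
Qed.

Lemma delayed_contraction_cvg0 (R : realType) (m : nat) (w : nat -> R)
    (q : int -> R) (M : R) :
  (forall j, `|q j| <= M) ->
  (forall k : nat, q k%:Z = \sum_(1 <= i < m.+1) w i * q (k%:Z - i%:Z)) ->
  \sum_(1 <= i < m.+1) `|w i| < 1 ->
  (fun k : nat => q k%:Z) @ \oo --> (0 : R).
Proof.
move=> qM qrec; set rho := (X in X < 1) => rho1.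
have rho0 : 0 <= rho by exact: sumr_ge0.
have geo : geometric M rho @ \oo --> (0 : R).
  by apply: cvg_geometric; rewrite ger0_norm.
apply/cvgr0Pnorm_le => e e0.
have /cvgr0Pnorm_le /(_ e e0) [n _ /(_ n (leqnn n)) /= Mn] := geo.
exists (n * m)%N => // k /= nk.
apply: le_trans (delayed_contraction_bound qM qrec (n := n) _) _; first by nia.
exact: le_trans (ler_norm _) Mn.
Qed.

Lemma head_prob_bounds (R : realType) (d : measure_display)
    (T : measurableType d) (P : probability T R) (X : int -> {RV P >-> R})
    (k : int) : 0 <= head_prob X k <= 1.
Proof.
have mH := measurable_heads X k.
rewrite /head_prob fine_ge0 //= -lee_fin fineK ?fin_num_measure //.
exact: probability_le1.
Qed.

Theorem mainTheorem2 (R : realType) (d : measure_display)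
    (T : measurableType d) (P : probability T R)
    (m : nat) (x : int -> R) (w : nat -> R) (X : int -> {RV P >-> R})
    (hm : (1 < m)%N)
    (hx : forall i : nat, (1 <= i <= m)%N ->
       x (- i%:Z) = 1 \/ x (- i%:Z) = -1)
    (hw : `|w 0%N - 2^-1| + \sum_(1 <= i < m.+1) `|w i| < 2^-1)
    (hX : coin_process m x w X) :
  [/\ forall k : nat,
        head_prob X k%:Z =
        w 0%N - \sum_(1 <= i < m.+1) w i
        + 2 * \sum_(1 <= i < m.+1) w i * head_prob X (k%:Z - i%:Z),
      forall i : nat, (1 <= i <= m)%N ->
        head_prob X (- i%:Z) = (x (- i%:Z) + 1) / 2
    & (fun k : nat => head_prob X k%:Z) @ \oo -->
        (w 0%N - \sum_(1 <= i < m.+1) w i)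
        / (1 - 2 * \sum_(1 <= i < m.+1) w i)].
Proof.
case: hX => pm1 init _ trans.
have prec := head_prob_rec pm1 trans.
split=> [//|i im|].
  rewrite /head_prob; case: (hx _ im) => xi; rewrite xi.
    rewrite (_ : heads _ _ = setT) ?probability_setT /=; first by lra.
    by apply/seteqP; split=> t // _; rewrite /heads /= init.
  rewrite (_ : heads _ _ = set0) ?measure0 /=; first by lra.
  by rewrite -subset0 => t; rewrite /heads /= init // xi; lra.
have hS : \sum_(1 <= i < m.+1) `|w i| < 2^-1.
  by apply: le_lt_trans hw; rewrite lerDr.
set S := \sum_(1 <= i < m.+1) w i.
have S2 : 1 - 2 * S != 0.
  have : S <= \sum_(1 <= i < m.+1) `|w i|.
    by apply: ler_sum => i _; exact: ler_norm.
  by move=> ?; apply/eqP; lra.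
set pinf := _ / _.
have pinfE : pinf = w 0%N - S + 2 * S * pinf by rewrite /pinf; field.
pose q j := head_prob X j - pinf.
have qM j : `|q j| <= 1 + `|pinf|.
  have /andP[p0 p1] := head_prob_bounds X j.
  by apply: le_trans (ler_normB _ _) _; rewrite lerD2r ger0_norm.
have qrec (k : nat) :
    q k%:Z = \sum_(1 <= i < m.+1) (2 * w i) * q (k%:Z - i%:Z).
  rewrite /q prec {1}pinfE -/S.
  under [RHS]eq_bigr => i _ do rewrite mulrBr -mulrA.
  rewrite sumrB -!mulr_sumr -!mulr_suml -mulr_sumr -/S; ring.
have q0 : (fun k : nat => q k%:Z) @ \oo --> (0 : R).
  apply: (delayed_contraction_cvg0 qM qrec).
  under eq_bigr => i _ do rewrite normrM ger0_norm //.
  by rewrite -mulr_sumr; lra.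
by apply/subr_cvg0.
Qed.
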